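(* Let $|q|<1$ and define integers $c_n,d_n$ by $$\sum_{n=0}^{\infty}c_nq^n=(-q,-q^4;q^5)_\infty^3(q^3,q^7;q^{10})_\infty,\qquad \sum_{n=0}^{\infty}d_nq^n=(-q^2,-q^3;q^5)_\infty^3(q,q^9;q^{10})_\infty.$$ Then for all $n\ge0$, $$c_{5n}=d_{5n},\quad c_{5n+2}=d_{5n+2},\quad c_{5n+3}=d_{5n+3},\quad c_{5n+4}=d_{5n+4}.$$ Furthermore, $$\sum_{n=0}^{\infty}c_{5n+1}q^n-\sum_{n=0}^{\infty}d_{5n+1}q^n=4\frac{f_2^4}{f_1^4},$$ and consequently $c_{5n+1}>d_{5n+1}$ for all $n\ge 0$.
   Context: For complex $a$ and $|q|<1$, $(a;q)_\infty=\prod_{k=0}^{\infty}(1-aq^k)$ and $(a_1,\dots,a_m;q)_\infty=(a_1;q)_\infty\cdots(a_m;q)_\infty$. For a positive integer $k$, $f_k:=(q^k;q^k)_\infty$. *)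

(* Defs.v *)
From mathcomp Require Export all_boot all_order all_algebra complex.
From mathcomp Require Export all_classical all_reals all_analysis.
Export numFieldNormedType.Exports.
Set Implicit Arguments.
Unset Strict Implicit.
Unset Printing Implicit Defensive.
Import Order.TTheory GRing.Theory Num.Theory.
Local Open Scope classical_set_scope.
Local Open Scope ring_scope.

(* The analytic notions are stated over a generic numFieldType, which carries
   the topology of its norm, and are meant to be used at C := R[i]. *)

(* (a; q)_oo; the limit exists whenever `|q| < 1. *)
Definition qpoch (C : numFieldType) (a q : C) : C :=
  limn (fun n => \prod_(0 <= k < n) (1 - a * q ^+ k)).

(* (a_1, ..., a_m; q)_oo *)
Definition qpochs (C : numFieldType) (s : seq C) (q : C) : C :=
  \prod_(a <- s) qpoch a q.

(* f_k = (q^k; q^k)_oo *)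
Definition feuler (C : numFieldType) (k : nat) (q : C) : C :=
  qpoch (q ^+ k) (q ^+ k).

(* Partial sums; exp.pseries is restricted to real coefficients. *)
Definition zpseries (C : numFieldType) (c : nat -> int) (q : C) : nat -> C :=
  series (fun n => (c n)%:~R * q ^+ n).

(* c is the coefficient sequence of the expansion of F on the unit disc. *)
Definition expands (C : numFieldType) (c : nat -> int) (F : C -> C) : Prop :=
  forall q : C, `|q| < 1 -> zpseries c q n @[n --> \oo] --> F q.

(* Main.v *)
(* Write b_i = (q^i, q^(10-i); q^10), A_i = (-q^i, -q^(5-i); q^5),
   T_i = (q^i, q^(5-i); q^5) and u_k = (q^k; q^k).  The Jacobi triple product turns
   A_1 T_2 u_5^2 and A_2 T_1 u_5^2 into double theta series; splitting the index
   lattice by parity gives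
     A_1 T_2 u_5^2 = (b_3 b_4 + q b_1 b_2) u_10^2,
     A_2 T_1 u_5^2 = (b_3 b_4 - q b_1 b_2) u_10^2.
   Since A_i T_i = b_(2i), T_1 = b_1 b_4 and T_2 = b_2 b_3, the difference of the
   squares of these identities is
     A_1^3 b_3 - A_2^3 b_1 = 4 q (-q^5; q^5)^4,
   and (-q; q) = f_2 / f_1 has positive coefficients.  The identities are proved in
   an arbitrary commutative ring with a nilpotent q, where infinite products and
   theta series are finite; the rings Z[X]/(X^N) then give every coefficient.
   Analytically, a product is the limit of integer polynomials whose coefficients
   stabilise and are uniformly dominated on each circle of radius s < 1, so it is
   the sum of the power series of the stable coefficients. *)
From HB Require Import structures.
Require Import Defs.
From mathcomp Require Import zify ring lra.
Set Implicit Arguments.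
Unset Strict Implicit.
Unset Printing Implicit Defensive.
Import Order.TTheory GRing.Theory Num.Theory.
Local Open Scope classical_set_scope.
Local Open Scope ring_scope.
Local Open Scope complex_scope.

(** * Gaussian binomials and the finite form of the Jacobi triple product *)

Section GaussianBinomial.
Variables (A : comNzRingType) (p : A).

(** A Pascal rule serves as definition because q-factorials cannot be divided in an arbitrary
    commutative ring; [gbinom_qfact] recovers the quotient formula without division. *)
Fixpoint gbinom (m i : nat) : A :=
  match m, i with
  | _, 0 => 1
  | 0, _.+1 => 0
  | m'.+1, i'.+1 => gbinom m' i'.+1 + p ^+ (m' - i') * gbinom m' i'
  end.

Definition qfact (n : nat) : A := \prod_(k < n) (1 - p ^+ k.+1).

Lemma gbinomn0 m : gbinom m 0 = 1. Proof. by case: m. Qed.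

Lemma gbinomSS m i :
  gbinom m.+1 i.+1 = gbinom m i.+1 + p ^+ (m - i) * gbinom m i.
Proof. by []. Qed.

Lemma gbinom_small m i : (m < i)%N -> gbinom m i = 0.
Proof.
elim: m i => [|m IH] [|i] //= lt_mi.
by rewrite !IH ?mulr0 ?addr0 //; lia.
Qed.

(** The defining Pascal rule adds a factor on the [a] side of the triple product; this second rule
    adds one on the [b] side. *)
Lemma gbinomSS_dual m i :
  gbinom m.+1 i.+1 = p ^+ i.+1 * gbinom m i.+1 + gbinom m i.
Proof.
elim: m i => [|m IH] i.
  by case: i => [|i]; rewrite /= !(mulr0, mulr1, add0r, addr0) // expr0.
rewrite gbinomSS; case: (ltnP m.+1 i) => [lt_mi|le_im].
  by rewrite !gbinom_small ?mulr0 ?addr0 //; lia.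
case: i le_im => [|i] le_im.
  rewrite !gbinomn0 {1}IH [in RHS]gbinomSS !gbinomn0 !subn0 !mulr1 mulrDr.
  by rewrite -exprD add1n; ring.
rewrite {1}IH {1}IH [in RHS]gbinomSS [in RHS]gbinomSS.
have -> : (m.+1 - i.+1 = m - i)%N by lia.
case: (leqP i.+1 m) => [lt_im|le_mi]; last first.
  by rewrite !(@gbinom_small m i.+1) ?(@gbinom_small m i.+2) //; [ring | lia].
have -> : (m - i = (m - i.+1).+1)%N by lia.
by rewrite !exprS; ring.
Qed.

Lemma gbinom_qfact m i : (i <= m)%N ->
  gbinom m i * (qfact i * qfact (m - i)) = qfact m.
Proof.
have qfactS n : qfact n.+1 = qfact n * (1 - p ^+ n.+1).
  by rewrite /qfact big_ord_recr.
have qfact0 : qfact 0 = 1 by rewrite /qfact big_ord0.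
elim: m i => [|m IH] [|i] //= le_im; rewrite ?qfact0 ?subn0 ?mul1r //.
rewrite subSS mulrDl.
case: (ltnP i m) => [lt_im|le_mi]; last first.
  have -> : i = m by lia.
  have := IH m (leqnn m); rewrite (@gbinom_small m m.+1) // subnn qfact0 expr0 !mulr1.
  by rewrite mul0r add0r mul1r qfactS mulrA => ->.
have Em : (m - i = (m - i.+1).+1)%N by lia.
have E1 := IH _ lt_im; have E2 := IH _ (ltnW lt_im).
have -> : gbinom m i.+1 * (qfact i.+1 * qfact (m - i)) =
   qfact m * (1 - p ^+ (m - i)).
  by rewrite -E1 Em (qfactS (m - i.+1)%N); ring.
have -> : p ^+ (m - i) * gbinom m i * (qfact i.+1 * qfact (m - i)) =
   qfact m * (p ^+ (m - i) * (1 - p ^+ i.+1)).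
  by rewrite -E2 (qfactS i); ring.
rewrite -mulrDr qfactS; congr (_ * _).
have -> : p ^+ m.+1 = p ^+ (m - i) * p ^+ i.+1.
  by rewrite -exprD; congr (_ ^+ _); lia.
ring.
Qed.

End GaussianBinomial.
Arguments gbinom : simpl never.

(** Since j (j + 1) is nonnegative for every integer j, the absolute value loses nothing. *)
Definition tri (j : int) : nat := `|(j * (j + 1) %/ 2)%Z|%N.

Lemma triE (j : int) : (tri j)%:Z * 2 = j * (j + 1).
Proof.
rewrite /tri; have [k Ek] : exists k : int, j * (j + 1) = k * 2.
  have Ej := divz_eq j 2; set h := (j %/ 2)%Z in Ej.
  have [E|E] : (j %% 2)%Z = 0 \/ (j %% 2)%Z = 1 by lia.
    by exists (h * (j + 1)); rewrite {1}Ej E; ring.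
  by exists ((h + 1) * j); rewrite {2}Ej E; ring.
by rewrite Ek mulzK //; nia.
Qed.

Section Theta.
Variable A : comNzRingType.

(* The general term of Ramanujan's theta function f(a, b). *)
Definition theta_term (a b : A) (j : int) : A := a ^+ tri j * b ^+ tri (- j).

(** The weight coming from Pascal's rule converts the shifted theta term into the old one times the
    new factor's monomial; the exponents of [a] and [b] agree separately. *)
Lemma theta_termS (a b : A) (m n i : nat) : (i <= m + n)%N ->
  (a * b) ^+ (m + n - i) * theta_term a b (i.+1%:Z - n%:Z) =
  a * (a * b) ^+ m * theta_term a b (i%:Z - n%:Z).
Proof.
move=> le_i; rewrite /theta_term !exprMn.
have := triE (i.+1%:Z - n%:Z); have := triE (- (i.+1%:Z - n%:Z)).
have := triE (i%:Z - n%:Z); have := triE (- (i%:Z - n%:Z)).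
move: (tri _) (tri _) (tri _) (tri _) => z y x w E1 E2 E3 E4.
transitivity (a ^+ (m + n - i + z) * b ^+ (m + n - i + y)).
  by rewrite !exprD; ring.
transitivity (a ^+ (1 + m + x) * b ^+ (m + w)).
  by congr (_ ^+ _ * _ ^+ _); nia.
by rewrite !exprD; ring.
Qed.

Lemma theta_termP (a b : A) (n i : nat) : (i <= n)%N ->
  (a * b) ^+ i * theta_term a b (i%:Z - n.+1%:Z) =
  b * (a * b) ^+ n * theta_term a b (i%:Z - n%:Z).
Proof.
move=> le_i; rewrite /theta_term !exprMn.
have := triE (i%:Z - n.+1%:Z); have := triE (- (i%:Z - n.+1%:Z)).
have := triE (i%:Z - n%:Z); have := triE (- (i%:Z - n%:Z)).
move: (tri _) (tri _) (tri _) (tri _) => z y x w E1 E2 E3 E4.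
transitivity (a ^+ (i + z) * b ^+ (i + y)).
  by rewrite !exprD; ring.
transitivity (a ^+ (n + x) * b ^+ (1 + n + w)).
  by congr (_ ^+ _ * _ ^+ _); nia.
by rewrite !exprD; ring.
Qed.

(** Induction on [n] at m = 0 with the dual Pascal rule, then on [m] with the defining one. *)
Lemma finite_triple_product (a b : A) (m n : nat) :
  \prod_(k < m) (1 + a * (a * b) ^+ k) * \prod_(k < n) (1 + b * (a * b) ^+ k) =
  \sum_(i < (m + n).+1)
     gbinom (a * b) (m + n) i * theta_term a b (i%:Z - n%:Z).
Proof.
set p := a * b.
have t0 : theta_term a b 0 = 1 by rewrite /theta_term mul1r.
elim: m => [|m IHm].
  rewrite big_ord0 mul1r; elim: n => [|n IHn].
    by rewrite big_ord0 big_ord1 subrr t0 mulr1.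
  rewrite big_ord_recr /= IHn !add0n mulrDr mulr1 addrC [RHS]big_ord_recl /= gbinomn0.
  rewrite mul1r /=.
  under [X in _ = _ + X]eq_bigr => i _.
    rewrite /bump leq0n add1n gbinomSS_dual mulrDl.
    have -> : i.+1%:Z - n.+1%:Z = i%:Z - n%:Z by lia.
    over.
  rewrite big_split /= addrA; congr (_ + _).
  rewrite [X in _ = _ + X]big_ord_recr /= gbinom_small // mulr0 mul0r addr0.
  rewrite [X in X * _]big_ord_recl mulrDl /= gbinomn0 mul1r; congr (_ + _).
    by have := @theta_termP a b n 0 isT; rewrite mul1r mulrC => ->.
  rewrite mulr_suml; apply: eq_bigr => i _; rewrite /bump leq0n add1n.
  have := @theta_termP a b n i.+1 (ltn_ord i).
  have -> : i.+1%:Z - n.+1%:Z = i%:Z - n%:Z by lia.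
  rewrite -/p => E.
  transitivity (gbinom p n i.+1 * (b * p ^+ n * theta_term a b (i.+1%:Z - n%:Z))).
    by ring.
  by rewrite -E; ring.
rewrite big_ord_recr /= mulrAC IHm mulrDr mulr1 addSn [RHS]big_ord_recl /= gbinomn0.
under [X in _ = _ + X]eq_bigr => i _ do rewrite /bump leq0n add1n gbinomSS mulrDl.
rewrite big_split /= addrA; congr (_ + _).
  rewrite [LHS]big_ord_recl /= gbinomn0; congr (_ + _).
  by rewrite [RHS]big_ord_recr /= gbinom_small // mul0r addr0.
rewrite mulr_suml; apply: eq_bigr => i _.
have := @theta_termS a b m n i; rewrite -ltnS ltn_ord => /(_ isT).
rewrite -/p => E.
transitivity (gbinom p (m + n) i * (a * p ^+ m * theta_term a b (i%:Z - n%:Z))).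
  by ring.
by rewrite -E; ring.
Qed.

End Theta.

Lemma signr_parity (A : pzRingType) (s : A) (m n : nat) :
  s * s = 1 -> odd m = odd n -> s ^+ m = s ^+ n.
Proof.
move=> s2 mn; rewrite -(odd_double_half m) -(odd_double_half n) mn.
by rewrite !exprD -!mul2n !exprM expr2 s2 !expr1n.
Qed.

(** Allows finite boxes to stand for the whole lattice: only the nonzero terms have to be matched
    when a double sum is reindexed. *)
Lemma eq_sum_support (A : nmodType) (I : eqType) (s t : seq I) (F : I -> A) :
  uniq s -> uniq t -> (forall x, F x != 0 -> (x \in s) && (x \in t)) ->
  \sum_(x <- s) F x = \sum_(x <- t) F x.
Proof.
move=> us ut st.
have supp r : \sum_(x <- r) F x = \sum_(x <- [seq x <- r | F x != 0]) F x.
  by rewrite big_filter [RHS]big_mkcond; apply: eq_bigr => x _; case: eqVneq.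
rewrite supp [RHS]supp; apply: perm_big; apply: uniq_perm; rewrite ?filter_uniq //.
by move=> x; rewrite !mem_filter; case: eqVneq => //= /st /andP[] -> ->.
Qed.

Definition zbox (L : nat) : seq int := [seq i%:Z - L%:Z | i <- iota 0 (L + L).+1].

Lemma mem_zbox L (j : int) : (j \in zbox L) = (`|j| <= L)%N.
Proof.
apply/mapP/idP => [[k]|le_jL]; first by rewrite mem_iota => /andP[_ lt_k] ->; lia.
by exists (absz (j + L%:Z)); rewrite ?mem_iota; lia.
Qed.

Lemma zbox_uniq L : uniq (zbox L).
Proof. by rewrite map_inj_uniq ?iota_uniq // => i j; lia. Qed.

(** * Product and theta identities at a nilpotent q *)

Definition qprod (A : pzRingType) (q e : A) (i r n : nat) : A :=
  \prod_(k < n) (1 - e * q ^+ (i + r * k)).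

Section Nilpotent.
Variables (A : comNzRingType) (q : A) (N : nat).
Hypothesis qN : q ^+ N = 0.

Local Notation qp := (qprod q).

Lemma nilp_expr m : (N <= m)%N -> q ^+ m = 0.
Proof. by move=> le_Nm; rewrite -(subnK le_Nm) exprD qN mulr0. Qed.

(** A factor of index at least [N] is 1 because its power of q vanishes, so every truncation with n
    >= N represents the infinite product. *)
Lemma qprod_stable e i r n : (0 < r)%N -> (N <= n)%N -> qp e i r n = qp e i r N.
Proof.
move=> r0 /subnK <-; elim: (n - N)%N => [|m IH]; first by rewrite add0n.
rewrite addSn /qprod big_ord_recr /= -/(qp _ _ _ _) IH nilp_expr ?mulr0 ?subr0 ?mulr1 //.
by nia.
Qed.

(* A factor 1 + (nilpotent) is a unit. *)
Lemma qprod_cancel e i r n x y :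
  (0 < i)%N -> qp e i r n * x = qp e i r n * y -> x = y.
Proof.
move=> i0; elim: n x y => [|n IH] x y; first by rewrite /qprod big_ord0 !mul1r.
rewrite /qprod big_ord_recr /= -/(qp _ _ _ _) -!mulrA => /IH /eqP.
set z := e * _; rewrite -subr_eq0 -mulrBr => /eqP.
set w := x - y; rewrite mulrBl mul1r => /eqP; rewrite subr_eq0 => /eqP Ew.
have {}Ew m : w = z ^+ m * w.
  by elim: m => [|m Em]; rewrite ?mul1r // exprS -mulrA -Em.
apply/eqP; rewrite -subr_eq0 -/w (Ew N) /z exprMn -exprM nilp_expr ?mulr0 ?mul0r //.
by nia.
Qed.

(** Separate the factors of even and odd index. Stability replaces [n] by 2n factors on the left,
    which makes the counts match. *)
Lemma qprod_double e i r n : (0 < r)%N -> (N <= n)%N ->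
  qp e i r n = qp e i (2 * r) n * qp e (i + r) (2 * r) n.
Proof.
move=> r0 le_Nn; rewrite (qprod_stable _ _ r0 le_Nn).
rewrite -(@qprod_stable e i r (n + n)) //; last by lia.
elim: {le_Nn}n => [|n IH]; first by rewrite /qprod !big_ord0 mulr1.
rewrite addnS addSn /qprod !big_ord_recr /= -!/(qp _ _ _ _) IH.
have -> : (i + r * (n + n) = i + 2 * r * n)%N by lia.
have -> : (i + r * (n + n).+1 = i + r + 2 * r * n)%N by lia.
by ring.
Qed.

Lemma qprod_sqr e i r n : e * e = 1 ->
  qp e i r n * qp (- e) i r n = qp 1 (2 * i) (2 * r) n.
Proof.
move=> e2; rewrite /qprod -big_split /=; apply: eq_bigr => k _.
have -> : (2 * i + 2 * r * k = (i + r * k) + (i + r * k))%N by lia.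
move: (i + r * k)%N => m; rewrite exprD; set z := q ^+ _.
by transitivity (1 - e * e * (z * z)); [ring | rewrite e2].
Qed.

(** The exponent of [s] is tri j + tri (-j) = j^2, which has the parity of j. *)
Lemma theta_termE (s : A) i k j : s * s = 1 ->
  theta_term (s * q ^+ i) (s * q ^+ k) j =
  s ^+ `|j| * q ^+ (i * tri j + k * tri (- j)).
Proof.
move=> s2; rewrite /theta_term !exprMn -!exprM.
transitivity (s ^+ (tri j + tri (- j)) * q ^+ (i * tri j + k * tri (- j))).
  by rewrite !exprD; ring.
congr (_ * _); apply: signr_parity => //.
have := triE j; have := triE (- j).
move: (tri _) (tri _) => x y E1 E2.
have -> : (x + y = `|j| * `|j|)%N by nia.
by rewrite oddM andbb.
Qed.

(** The exponent of q is at least tri j + tri (-j) = j^2 >= |j|. *)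
Lemma theta_term_eq0 (s : A) i k j : s * s = 1 -> (0 < i)%N -> (0 < k)%N ->
  (N <= `|j|)%N -> theta_term (s * q ^+ i) (s * q ^+ k) j = 0.
Proof.
move=> s2 i0 k0 le_Nj; rewrite theta_termE // nilp_expr ?mulr0 //.
have := triE j; have := triE (- j).
by move: (tri _) (tri _) => x y; nia.
Qed.

(** This is the finite triple product with [L] factors on each side: central Gaussian binomials
    become the inverse of (q^r; q^r), and the remaining theta terms vanish. *)
Lemma triple_product (e : A) i r n L : e * e = 1 -> (0 < i < r)%N ->
  (N <= n)%N -> (2 * N <= L)%N ->
  qp e i r n * qp e (r - i) r n * qp 1 r r n =
  \sum_(j <- zbox L) theta_term (- e * q ^+ i) (- e * q ^+ (r - i)) j.
Proof.
move=> e2 /andP[i0 ir] le_Nn le_NL.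
set a := - e * _; set b := - e * _.
have ne2 : - e * - e = 1 by rewrite mulrNN.
have r0 : (0 < r)%N by lia.
have ab : a * b = q ^+ r.
  by rewrite /a /b mulrACA ne2 mul1r -exprD subnKC // ltnW.
have le_NL' : (N <= L)%N by lia.
have qfactE m : qfact (a * b) m = qp 1 r r m.
  rewrite ab; apply: eq_bigr => k _; rewrite mul1r -exprM; congr (1 - q ^+ _).
  by rewrite mulnS.
have qpE c d m : (0 < d)%N -> c = - e * q ^+ d ->
    qp e d r m = \prod_(k < m) (1 + c * (a * b) ^+ k).
  by move=> d0 ->; apply: eq_bigr => k _; rewrite ab -exprM exprD; ring.
have st d f : qp f d r n = qp f d r L by rewrite !(@qprod_stable f d r) // r0.
rewrite !st (@qpE a i L) // (@qpE b (r - i)%N L) ?subn_gt0 //.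
rewrite finite_triple_product mulr_suml big_map -[X in iota _ X]/(L + L).+1.
rewrite -[iota _ _]/(index_iota 0 (L + L).+1) big_mkord.
apply: eq_bigr => k _.
have [far|near] := boolP ((N <= `|k%:Z - L%:Z|)%N).
  by rewrite theta_term_eq0 ?mulr0 ?mul0r // subn_gt0.
(* As |k - L| < N and 2N <= L, both k and 2L - k are at least N. All q-factorials in [gbinom_qfact]
   then equal the full product, and one copy cancels. *)
suff E : gbinom (a * b) (L + L) k * qp 1 r r L = 1 by rewrite mulrAC E mul1r.
have lt_k := ltn_ord k.
have := @gbinom_qfact A (a * b) (L + L) k; rewrite -ltnS => /(_ lt_k).
rewrite !qfactE !(@qprod_stable 1 r r) //; try lia.
by move=> E; apply: (@qprod_cancel 1 r r N) => //; rewrite mulr1 -[RHS]E; ring.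
Qed.

(* The pairs (m, n) with m + n even are (u + v, u - v), those with m + n odd are
   (1 - u - v, v - u). *)
Lemma theta_parity_split (s : A) L : s * s = 1 -> (N <= L)%N ->
  (\sum_(j <- zbox L) theta_term (s * q ^+ 1) (s * q ^+ 4) j) *
  (\sum_(j <- zbox L) theta_term (- s * q ^+ 2) (- s * q ^+ 3) j) =
  (\sum_(j <- zbox L) theta_term (-1 * q ^+ 3) (-1 * q ^+ 7) j) *
  (\sum_(j <- zbox L) theta_term (-1 * q ^+ 4) (-1 * q ^+ 6) j) +
  s * q * ((\sum_(j <- zbox L) theta_term (-1 * q ^+ 2) (-1 * q ^+ 8) j) *
  (\sum_(j <- zbox L) theta_term (-1 * q ^+ 1) (-1 * q ^+ 9) j)).
Proof.
move=> s2 le_NL.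
have ns2 : - s * - s = 1 by rewrite mulrNN.
have n1 : -1 * -1 = 1 :> A by rewrite mulrNN mulr1.
rewrite !big_distrlr /= mulr_sumr; under [in X in _ + X]eq_bigr do rewrite mulr_sumr.
set box2 := [seq (u, v) | u <- zbox L, v <- zbox L].
have box2_uniq : uniq box2.
  by apply: allpairs_uniq; rewrite ?zbox_uniq // => -[? ?] [? ?].
have mem_box2 u v : ((u, v) \in box2) = (`|u| <= L)%N && (`|v| <= L)%N.
  rewrite -!mem_zbox; apply/allpairsP/andP => [[[u' v'] [? ? [] -> ->]] //|[? ?]].
  by exists (u, v).
pose F (x : int * int) := theta_term (s * q ^+ 1) (s * q ^+ 4) x.1 *
   theta_term (- s * q ^+ 2) (- s * q ^+ 3) x.2.
pose phi0 (x : int * int) := (x.1 + x.2, x.1 - x.2).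
pose phi1 (x : int * int) := (1 - x.1 - x.2, x.2 - x.1).
have sgn1 m n : odd m = odd n -> (-1) ^+ m = (-1) ^+ n :> A by exact: signr_parity.
have sgns m n : odd m = odd n -> s ^+ m = s ^+ n by exact: signr_parity.
have nsE m : (- s) ^+ m = (-1) ^+ m * s ^+ m by rewrite -exprMn mulN1r.
(* Here |u + v| + |u - v| is even, so [s] disappears, and the cross terms in u v cancel in the
   exponent. *)
have F0 u v : F (phi0 (u, v)) = theta_term (-1 * q ^+ 3) (-1 * q ^+ 7) u *
    theta_term (-1 * q ^+ 4) (-1 * q ^+ 6) v.
  rewrite /F !theta_termE //= nsE.
  set x1 := tri _; set x2 := tri _; set x3 := tri _; set x4 := tri _.
  set y1 := tri _; set y2 := tri _; set y3 := tri _; set y4 := tri _.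
  transitivity ((-1) ^+ `|(u - v)%R| * s ^+ (`|(u + v)%R| + `|(u - v)%R|) *
    q ^+ (1 * x1 + 4 * x2 + (2 * x3 + 3 * x4))); first by rewrite !exprD; ring.
  transitivity ((-1) ^+ (`|u| + `|v|) * q ^+ (3 * y1 + 7 * y2 + (4 * y3 + 6 * y4)));
    last by rewrite !exprD; ring.
  rewrite (sgns _ 0%N) ?mulr1; last by lia.
  congr (_ * q ^+ _); first by apply: sgn1; lia.
  have := triE (u + v); have := triE (- (u + v)); have := triE (u - v).
  have := triE (- (u - v)); have := triE u; have := triE (- u).
  have := triE v; have := triE (- v).
  rewrite -/x1 -/x2 -/x3 -/x4 -/y1 -/y2 -/y3 -/y4; clearbody x1 x2 x3 x4 y1 y2 y3 y4.
  by lia.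
(* Now |1 - u - v| + |v - u| is odd, so one factor [s] survives; the exponent has constant term
   1. *)
have F1 u v : F (phi1 (u, v)) =
    s * q * (theta_term (-1 * q ^+ 2) (-1 * q ^+ 8) u *
    theta_term (-1 * q ^+ 1) (-1 * q ^+ 9) v).
  rewrite /F !theta_termE //= nsE.
  set x1 := tri _; set x2 := tri _; set x3 := tri _; set x4 := tri _.
  set y1 := tri _; set y2 := tri _; set y3 := tri _; set y4 := tri _.
  transitivity ((-1) ^+ `|(v - u)%R| * s ^+ (`|(1 - u - v)%R| + `|(v - u)%R|) *
    q ^+ (1 * x1 + 4 * x2 + (2 * x3 + 3 * x4))); first by rewrite !exprD; ring.
  transitivity ((-1) ^+ (`|u| + `|v|) * s ^+ 1 *
     q ^+ (1 + (2 * y1 + 8 * y2 + (1 * y3 + 9 * y4))));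
    last by rewrite !exprD; ring.
  congr (_ * _ * q ^+ _); [by apply: sgn1; lia|by apply: sgns; lia|].
  have := triE (1 - u - v); have := triE (- (1 - u - v)); have := triE (v - u).
  have := triE (- (v - u)); have := triE u; have := triE (- u).
  have := triE v; have := triE (- v).
  rewrite -/x1 -/x2 -/x3 -/x4 -/y1 -/y2 -/y3 -/y4; clearbody x1 x2 x3 x4 y1 y2 y3 y4.
  by lia.
transitivity (\sum_(x <- box2) F x); first by rewrite big_allpairs.
transitivity (\sum_(x <- [seq phi0 x | x <- box2] ++ [seq phi1 x | x <- box2]) F x);
  last first.
  rewrite big_cat (big_map phi0) (big_map phi1) /=; congr (_ + _); rewrite big_allpairs.
    by apply: eq_bigr => u _; apply: eq_bigr => v _; rewrite F0.
  by apply: eq_bigr => u _; apply: eq_bigr => v _; rewrite F1.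
have phi0_inj : injective phi0 by move=> [u v] [u' v'] [] *; congr (_, _); lia.
have phi1_inj : injective phi1 by move=> [u v] [u' v'] [] *; congr (_, _); lia.
(* The images of [phi0] and [phi1] are disjoint by the parity of the coordinate sum. Nonzero terms
   have |m|, |n| < N, hence lie in both index lists. *)
apply: eq_sum_support => //.
  rewrite cat_uniq !map_inj_uniq // box2_uniq andbT.
  apply/hasPn => _ /mapP[[u v] _ ->]; apply/mapP => -[[u' v'] _ []] *; lia.
move=> [m n] Fmn; have [ltm ltn] : (`|m| < N)%N /\ (`|n| < N)%N.
  split; rewrite ltnNge; apply: contraNN Fmn => le; rewrite /F /=.
    by rewrite (@theta_term_eq0 s 1 4) ?mul0r ?eqxx.
  by rewrite (@theta_term_eq0 (- s) 2 3) ?mulr0 ?eqxx.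
rewrite mem_box2 mem_cat; apply/andP; split; first by apply/andP; split; lia.
have [e|e] : ((m + n) %% 2)%Z = 0 \/ ((m + n) %% 2)%Z = 1 by lia.
  (* The witnesses here and below solve [phi0] (u, v) = (m, n) and [phi1] (u, v) = (m, n). *)
  apply/orP; left; apply/mapP; exists (((m + n) %/ 2)%Z, ((m - n) %/ 2)%Z).
    by rewrite mem_box2; apply/andP; split; lia.
  by rewrite /phi0 /=; congr (_, _); lia.
apply/orP; right; apply/mapP; exists (((1 - m - n) %/ 2)%Z, ((1 - m + n) %/ 2)%Z).
  by rewrite mem_box2; apply/andP; split; lia.
by rewrite /phi1 /=; congr (_, _); lia.
Qed.

(** The parity splitting at s = -e, with every theta series rewritten by the triple product; e = -1
    gives A_1 T_2 and e = 1 gives A_2 T_1. *)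
Lemma theta_product_split (e : A) n : e * e = 1 -> (N <= n)%N ->
  qp e 1 5 n * qp e 4 5 n * (qp (- e) 2 5 n * qp (- e) 3 5 n) * qp 1 5 5 n ^+ 2 =
  (qp 1 3 10 n * qp 1 7 10 n * (qp 1 4 10 n * qp 1 6 10 n) -
   e * q * (qp 1 2 10 n * qp 1 8 10 n * (qp 1 1 10 n * qp 1 9 10 n))) *
  qp 1 10 10 n ^+ 2.
Proof.
move=> e2 le_Nn.
have ne2 : - e * - e = 1 by rewrite mulrNN.
have := @theta_parity_split (- e) (2 * N) ne2 (@leq_pmull N 2 isT).
have JTP f i k r : f * f = 1 -> (0 < i)%N -> (0 < k)%N -> r = (i + k)%N ->
    \sum_(j <- zbox (2 * N)) theta_term (- f * q ^+ i) (- f * q ^+ k) j =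
    qp f i r n * qp f k r n * qp 1 r r n.
  move=> f2 i0 k0 ->; have := @triple_product f i (i + k) n (2 * N) f2.
  by rewrite addKn => ->; rewrite ?i0 ?leqnn //; lia.
have e1 : 1 * 1 = 1 :> A by rewrite mulr1.
rewrite (JTP e 1%N 4 5) // (JTP (- e) 2 3 5) // (JTP 1 3 7 10) //.
rewrite (JTP 1 4 6 10) // (JTP 1 2 8 10) // (JTP 1 1%N 9 10) //.
move: (qp e _ _ _) (qp e _ _ _) (qp (- e) _ _ _) (qp (- e) _ _ _) => a4 a1 a3 a2.
move: (qp 1 1 10 n) (qp 1 2 10 n) (qp 1 3 10 n) (qp 1 4 10 n) => x1 x2 x3 x4.
move: (qp 1 6 10 n) (qp 1 7 10 n) (qp 1 8 10 n) (qp 1 9 10 n) => x6 x7 x8 x9.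
move: (qp 1 5 5 n) (qp 1 10 10 n) => u5 u10 E.
transitivity (a1 * a4 * u5 * (a2 * a3 * u5)); first by ring.
by rewrite E; ring.
Qed.

Lemma qprod_identity n : (N <= n)%N ->
  (qp (-1) 1 5 n * qp (-1) 4 5 n) ^+ 3 * (qp 1 3 10 n * qp 1 7 10 n) -
  (qp (-1) 2 5 n * qp (-1) 3 5 n) ^+ 3 * (qp 1 1 10 n * qp 1 9 10 n) =
  4 * (q * qp (-1) 5 5 n ^+ 4).
Proof.
move=> le_Nn.
have e1 : 1 * 1 = 1 :> A by rewrite mulr1.
have n1 : -1 * -1 = 1 :> A by rewrite mulrNN mulr1.
have S := theta_product_split n1 le_Nn; have M := theta_product_split e1 le_Nn.
have sq i : qp 1 i 5 n * qp (-1) i 5 n = qp 1 (2 * i) 10 n := @qprod_sqr 1 i 5 n e1.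
have db i : qp 1 i 5 n = qp 1 i 10 n * qp 1 (i + 5) 10 n.
  exact: @qprod_double 1 i 5 n isT le_Nn.
have := sq 1%N; have := sq 2; have := sq 3; have := sq 4; have := sq 5.
have := db 1%N; have := db 2; have := db 3; have := db 4.
have c i r x y := @qprod_cancel 1 i r n x y.
rewrite /= => t4E t3E t2E t1E u10E x8E x6E x4E x2E.
(* It suffices to prove the identity after multiplication by the cancellable u_5^4 b_1 b_2 b_3
   b_4. *)
do 4![apply: (c 5 5) => //]; apply: (c 1%N 10) => //; apply: (c 2 10) => //.
apply: (c 3 10) => //; apply: (c 4 10) => //; apply: (c 6 10) => //.
apply: (c 7 10) => //; apply: (c 8 10) => //; apply: (c 9 10) => //.
clear c sq db; move: t4E t3E t2E t1E u10E x8E x6E x4E x2E S M.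
rewrite !opprK !mulN1r !mul1r.
move: (qp 1 1 5 n) (qp 1 2 5 n) (qp 1 3 5 n) (qp 1 4 5 n) => t1 t2 t3 t4.
move: (qp (-1) 1 5 n) (qp (-1) 2 5 n) (qp (-1) 3 5 n) (qp (-1) 4 5 n) => a1 a2 a3 a4.
move: (qp 1 1 10 n) (qp 1 2 10 n) (qp 1 3 10 n) (qp 1 4 10 n) => x1 x2 x3 x4.
move: (qp 1 6 10 n) (qp 1 7 10 n) (qp 1 8 10 n) (qp 1 9 10 n) => x6 x7 x8 x9.
move: (qp 1 5 5 n) (qp (-1) 5 5 n) (qp 1 10 10 n) => u5 E u10.
move=> t4E t3E t2E t1E u10E x8E x6E x4E x2E S M.
(* Since b_1 b_4 A_1 = T_1 A_1 = b_2 and b_2 b_3 = T_2, the left side becomes the square of A_1 T_2.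
   The companion [DE] uses T_2 A_2 = b_4 and b_1 b_4 = T_1. *)
have CE : x1 * x2 * x3 * x4 * x6 * x7 * x8 * x9 * ((a1 * a4) ^+ 3 * (x3 * x7)) =
    (a1 * a4 * (t2 * t3)) ^+ 2.
  transitivity ((t1 * a1) * (t4 * a4) * (x2 * x8 * (a1 * a4 * (x3 * x7)) ^+ 2)).
    by rewrite t1E t4E; ring.
  by rewrite x2E x8E t2E t3E; ring.
have DE : x1 * x2 * x3 * x4 * x6 * x7 * x8 * x9 * ((a2 * a3) ^+ 3 * (x1 * x9)) =
    (t1 * t4 * (a2 * a3)) ^+ 2.
  transitivity ((t2 * a2) * (t3 * a3) * (x4 * x6 * (a2 * a3 * (x1 * x9)) ^+ 2)).
    by rewrite t2E t3E; ring.
  by rewrite x4E x6E t1E t4E; ring.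
transitivity ((a1 * a4 * (t2 * t3) * u5 ^+ 2) ^+ 2 -
              (t1 * t4 * (a2 * a3) * u5 ^+ 2) ^+ 2).
  transitivity (u5 ^+ 4 * ((a1 * a4 * (t2 * t3)) ^+ 2 - (t1 * t4 * (a2 * a3)) ^+ 2)).
    by rewrite -CE -DE; ring.
  by ring.
(* The difference of squares is 4 q b_1 b_2 b_3 b_4 u_10^4, and u_10 = u_5 (-q^5; q^5). *)
by rewrite S M -u10E; ring.
Qed.

End Nilpotent.

(** * Coefficients of the truncated products over the integers *)

Lemma qprodS (A : pzRingType) (q e : A) i r n :
  qprod q e i r n.+1 = qprod q e i r n * (1 - e * q ^+ (i + r * n)).
Proof. by rewrite /qprod big_ord_recr. Qed.

Lemma rmorph_qprod (A B : pzRingType) (f : {rmorphism A -> B}) (q e : A) i r n :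
  f (qprod q e i r n) = qprod (f q) (f e) i r n.
Proof.
rewrite /qprod rmorph_prod; apply: eq_bigr => k _.
by rewrite rmorphB rmorph1 rmorphM rmorphXn.
Qed.

(** Reduction modulo X^(N+1) keeps the coefficients up to degree [N], so identities in the quotient
    ring can be read coefficientwise. *)
Lemma in_qpolyXn_coef (A : comNzRingType) N (p p' : {poly A}) i :
  in_qpoly 'X^(N.+1) p = in_qpoly 'X^(N.+1) p' -> (i <= N)%N -> p`_i = p'`_i.
Proof.
move=> /(congr1 val) /=; rewrite mk_monic_Xn /= => Epp' le_iN.
have coef_mod (r : {poly A}) : r`_i = (Pdiv.CommonRing.rmodp r 'X^(N.+1))`_i.
  rewrite {1}(Pdiv.RingMonic.rdivp_eq (monicXn A N.+1) r) coefD coefMXn.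
  by rewrite ltnS le_iN add0r.
by rewrite coef_mod Epp' -coef_mod.
Qed.


Definition cpoly n : {poly int} :=
  (qprod 'X (-1) 1 5 n * qprod 'X (-1) 4 5 n) ^+ 3 *
  (qprod 'X 1 3 10 n * qprod 'X 1 7 10 n).

Definition dpoly n : {poly int} :=
  (qprod 'X (-1) 2 5 n * qprod 'X (-1) 3 5 n) ^+ 3 *
  (qprod 'X 1 1 10 n * qprod 'X 1 9 10 n).

(** Truncation of (-q; q)^4, that is, of f_2^4 / f_1^4. *)
Definition epoly n : {poly int} := qprod 'X (-1) 1 1 n ^+ 4.

Lemma rmorph_cpoly (B : comPzRingType) (f : {rmorphism {poly int} -> B}) n :
  f (cpoly n) =
  (qprod (f 'X) (-1) 1 5 n * qprod (f 'X) (-1) 4 5 n) ^+ 3 *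
  (qprod (f 'X) 1 3 10 n * qprod (f 'X) 1 7 10 n).
Proof. by rewrite rmorphM rmorphXn !rmorphM !rmorph_qprod rmorphN1 rmorph1. Qed.

Lemma rmorph_dpoly (B : comPzRingType) (f : {rmorphism {poly int} -> B}) n :
  f (dpoly n) =
  (qprod (f 'X) (-1) 2 5 n * qprod (f 'X) (-1) 3 5 n) ^+ 3 *
  (qprod (f 'X) 1 1 10 n * qprod (f 'X) 1 9 10 n).
Proof. by rewrite rmorphM rmorphXn !rmorphM !rmorph_qprod rmorphN1 rmorph1. Qed.

(** Modulo X^(i+1) the difference is 4 X E(X^5) with E = [epoly n], which has only exponents
    congruent to 1 modulo 5. *)
Lemma coef_cpolyB n i : (i < n)%N ->
  (cpoly n)`_i - (dpoly n)`_i =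
  if (i %% 5 == 1)%N then 4 * (epoly n)`_(i %/ 5) else 0.
Proof.
move=> lt_in.
have -> : (cpoly n)`_i - (dpoly n)`_i =
    (4 * ('X * (epoly n \Po 'X^5)))`_i :> int.
  rewrite -coefB; apply: (@in_qpolyXn_coef _ i) => //.
  (* The class of X is nilpotent of order i + 1 <= n, as [qprod_identity] requires. *)
  have fX : in_qpoly 'X^(i.+1) ('X : {poly int}) ^+ i.+1 = 0.
    rewrite -rmorphXn; apply: val_inj => /=.
    by rewrite mk_monic_Xn Pdiv.RingMonic.rmodpp // monicXn.
  have -> : epoly n \Po 'X^5 = qprod 'X (-1) 5 5 n ^+ 4.
    rewrite /epoly rmorphXn /= /qprod rmorph_prod /=; congr (_ ^+ 4).
    apply: eq_bigr => k _; rewrite !mulN1r !opprK rmorphD rmorph1 rmorphXn /= comp_polyX.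
    by rewrite -exprM mulnDr muln1 mul1n.
  rewrite rmorphB /= rmorph_cpoly rmorph_dpoly [RHS]rmorphM rmorph_nat.
  rewrite [X in _ = _ * X]rmorphM rmorphXn rmorph_qprod rmorphN1.
  exact: (qprod_identity fX).
rewrite -[4]/(4%:R) mulr_natl coefMn coefXM coef_comp_poly_Xn //.
case: i lt_in => [|i] lt_in; first by rewrite mul0rn.
rewrite /=; case: ifP => d5; case: eqP => m1; try lia.
have -> : (i.+1 %/ 5 = i %/ 5)%N by lia.
by rewrite mulr_natl.
Qed.

Lemma qprod_succ_coef_ge0 n i : 0 <= (qprod ('X : {poly int}) (-1) 1 1 n)`_i.
Proof.
elim: n i => [|n IH] i; first by rewrite /qprod big_ord0 coef1; case: eqP.
rewrite qprodS mulN1r opprK mulrDr mulr1 coefD coefMXn addr_ge0 //.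
by case: ifP.
Qed.

Lemma qprod_succ_coef_gt0 n i : (i <= n)%N ->
  0 < (qprod ('X : {poly int}) (-1) 1 1 n)`_i.
Proof.
elim: n i => [|n IH] i le_in.
  by rewrite /qprod big_ord0 coef1 (_ : i = 0%N) //; lia.
rewrite qprodS mulN1r opprK mulrDr mulr1 coefD coefMXn.
case: (leqP i n) => [le|gt].
  by apply: ltr_wpDr; [case: ifP => // _; exact: qprod_succ_coef_ge0 | exact: IH].
(* Only i = n + 1 is left: the new factor contributes the constant coefficient of the old
   product. *)
apply: ltr_wpDl; first exact: qprod_succ_coef_ge0.
by rewrite (_ : (i < 1 + 1 * n)%N = false) ?IH //; lia.
Qed.

Lemma coefM_gt0 (p p' : {poly int}) n :
  (forall i, 0 <= p`_i) -> (forall i, 0 <= p'`_i) -> 0 < p`_0 -> 0 < p'`_n ->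
  0 < (p * p')`_n.
Proof.
move=> p0 p'0 pn p'n; rewrite coefM big_ord_recl /= subn0.
by apply: ltr_wpDr; rewrite ?mulr_gt0 ?sumr_ge0 // => i _; rewrite mulr_ge0.
Qed.

Lemma coefM_ge0 (p p' : {poly int}) n :
  (forall i, 0 <= p`_i) -> (forall i, 0 <= p'`_i) -> 0 <= (p * p')`_n.
Proof. by move=> p0 p'0; rewrite coefM sumr_ge0 // => i _; rewrite mulr_ge0. Qed.

Lemma epoly_coef_gt0 n i : (i <= n)%N -> 0 < (epoly n)`_i.
Proof.
move=> le_in; have p0 := @qprod_succ_coef_ge0 n.
have pp := @qprod_succ_coef_gt0 n.
rewrite /epoly !exprS expr0 mulr1.
by do 3?[apply: coefM_gt0 => // *; rewrite ?pp ?coefM_ge0 // => *; rewrite ?coefM_ge0].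
Qed.

(** * Convergence of complex sequences and series *)

Section ComplexLimits.
Variable R : realType.
(* Limits are only inferred through the numFieldType structure of R[i]. *)
Local Notation C := (Num.NumField.sort (R[i] : numFieldType)).
Implicit Types (q z : C) (u : nat -> C).

Lemma normc_real z : exists2 r : R, 0 <= r & `|z| = r%:C.
Proof. by rewrite normc_def; eexists; last reflexivity; exact: sqrtr_ge0. Qed.

Lemma normc_realC (x : R) : `|x%:C : C| = `|x|%:C.
Proof. by rewrite normc_def /= expr0n /= addr0 sqrtr_sqr. Qed.

Lemma normc_i : `|'i%C : C| = 1.
Proof. by rewrite normc_def /= expr0n expr1n add0r sqrtr1. Qed.

Lemma cvg_complex_dist u (l : C) (v : nat -> R) :
  (forall n, `|l - u n| <= (v n)%:C) -> v @ \oo --> 0 -> u @ \oo --> l.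
Proof.
move=> uv v0; apply/cvgrPdist_lt => e e0.
(* A positive element of [R[i]] is real, so a real bound suffices. *)
have eE : e = (complex.Re e)%:C by rewrite RRe_real // gtr0_real.
rewrite eE ltcR in e0.
move/cvgrPdist_lt: v0 => /(_ _ e0) [n0 _ near_n0]; exists n0 => // n /near_n0 /=.
rewrite !sub0r !normrN => lt_ve; rewrite eE; apply: le_lt_trans (uv n) _.
by rewrite ltcR (le_lt_trans (ler_norm _)).
Qed.

(** Reduces convergence in C to the real line, where absolute convergence and comparison of series
    apply. *)
Lemma is_cvg_complex u :
  cvgn (fun n => complex.Re (u n)) -> cvgn (fun n => complex.Im (u n)) -> cvgn u.
Proof.
move=> /cvg_ex[a ca] /cvg_ex[b cb].
apply/cvg_ex; exists (a%:C + 'i%C * b%:C).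
have dist0 (v : nat -> R) (l : R) : v @ \oo --> l ->
    (fun n => `|l - v n|) @ \oo --> (0 : R).
  move=> vl; rewrite -(normr0 R) -(subrr l); apply: cvg_norm; apply: cvgB => //.
  exact: cvg_cst.
apply: (@cvg_complex_dist _ _
  (fun n => `|a - complex.Re (u n)| + `|b - complex.Im (u n)|)).
  move=> n; have -> : a%:C + 'i%C * b%:C - u n =
      (a - complex.Re (u n))%:C + 'i%C * (b - complex.Im (u n))%:C :> C.
    by rewrite {1}[u n]complexE !rmorphB mulrBr opprD addrACA.
  apply: le_trans (ler_normD _ _) _.
  by rewrite normrM normc_i mul1r !normc_realC -rmorphD.
by rewrite -(addr0 0); apply: cvgD; exact: dist0.
Qed.

Lemma is_cvg_series_geometric_bound u (K t : R) : 0 <= t < 1 ->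
  (forall n, `|u n| <= (K * t ^+ n)%:C) -> cvgn (series u).
Proof.
move=> /andP[t0 t1] bnd.
have cvg_geo (v : nat -> R) : (forall n, `|v n| <= K * t ^+ n) -> cvgn (series v).
  move=> vK; apply: normed_cvg.
  apply: (@series_le_cvg _ _ (geometric K t)) => [n|n|n|] //=.
    by apply: le_trans (vK n).
  by apply: is_cvg_geometric_series; rewrite ger0_norm.
apply: is_cvg_complex.
  have -> : (fun n => complex.Re (series u n)) = series (fun n => complex.Re (u n)).
    by apply/funext => n; rewrite /series /= (raddf_sum (@complex.Re R)).
  apply: cvg_geo => n; rewrite -lecR; exact: le_trans (normc_ge_Re _) (bnd n).
have -> : (fun n => complex.Im (series u n)) = series (fun n => complex.Im (u n)).
  by apply/funext => n; rewrite /series /= (raddf_sum (@complex.Im R)).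
apply: cvg_geo => n; rewrite -lecR; apply: le_trans (bnd n).
rewrite -normrN -ReiNIm; apply: le_trans (normc_ge_Re _) _.
by rewrite normrM normc_i mulr1.
Qed.

End ComplexLimits.

(** * Evaluation of integer polynomials, stable coefficients and uniform majorants *)

Definition zhorner (K : numFieldType) (q : K) : {poly int} -> K :=
  horner_eval q \o map_poly intr.

HB.instance Definition _ (K : numFieldType) (q : K) :=
  GRing.RMorphism.copy (zhorner q) (horner_eval q \o map_poly intr).

Lemma zhornerX (K : numFieldType) (q : K) : zhorner q 'X = q.
Proof. by rewrite /zhorner /= map_polyX /horner_eval hornerX. Qed.

Lemma zhorner_coef_wide (K : numFieldType) (q : K) (p : {poly int}) n :
  (size p <= n)%N -> zhorner q p = \sum_(0 <= i < n) (p`_i)%:~R * q ^+ i.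
Proof.
move=> le_pn; rewrite /zhorner /= /horner_eval big_mkord (@horner_coef_wide _ n).
  by apply: eq_bigr => i _; rewrite coef_map.
by rewrite (leq_trans _ le_pn) // size_poly.
Qed.

Definition coef_stable (P : nat -> {poly int}) : Prop :=
  forall i n, (i < n)%N -> (P n)`_i = (P i.+1)`_i.

(** A majorant polynomial is required, rather than a bound on each coefficient, so that the property
    passes directly to products. *)
Definition dominated (R : realType) (P : nat -> {poly int}) : Prop :=
  forall s : R, 0 < s < 1 -> exists K : R, forall n,
    exists2 Q : {poly int}, forall i, `|(P n)`_i| <= Q`_i & zhorner s Q <= K.

Lemma coef_stableM P Q : coef_stable P -> coef_stable Q ->
  coef_stable (fun n => P n * Q n).
Proof.
move=> sP sQ i n lt_in; rewrite !coefM; apply: eq_bigr => j _.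
have lt_j := ltn_ord j.
by rewrite sP ?[in RHS]sP ?sQ ?[in RHS]sQ //; lia.
Qed.

Lemma coef_stableX P k : coef_stable P -> coef_stable (fun n => P n ^+ k).
Proof.
move=> sP; elim: k => [|k IH]; first by move=> i n _; rewrite !expr0.
by under eq_fun do rewrite exprS; exact: coef_stableM.
Qed.

Lemma coef_stable_qprod (e : {poly int}) i r : (0 < r)%N ->
  coef_stable (qprod 'X e i r).
Proof.
move=> r0 j n; elim: n => [|n IH] //; rewrite ltnS leq_eqVlt => /orP[/eqP -> //|lt_jn].
rewrite -(IH lt_jn) qprodS mulrBr mulr1 coefB mulrA coefMXn ifT ?subr0 //.
by nia.
Qed.

Section Dominated.
Variable R : realType.
Local Notation C := (Num.NumField.sort (R[i] : numFieldType)).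

Lemma zhorner_ge0 (s : R) (Q : {poly int}) :
  0 <= s -> (forall i, 0 <= Q`_i) -> 0 <= zhorner s Q.
Proof.
move=> s0 Q0; rewrite (zhorner_coef_wide _ (leqnn _)) sumr_ge0 // => i _.
by rewrite mulr_ge0 ?exprn_ge0 // ler0z.
Qed.

Lemma dominatedM P Q : dominated R P -> dominated R Q ->
  dominated R (fun n => P n * Q n).
Proof.
move=> dP dQ s s01; have [K1 HK1] := dP s s01; have [K2 HK2] := dQ s s01.
have s0 : 0 <= s by case/andP: s01 => /ltW.
exists (K1 * K2) => n; have [P' PP' P'K] := HK1 n; have [Q' QQ' Q'K] := HK2 n.
have P'0 i : 0 <= P'`_i by apply: le_trans (PP' i).
have Q'0 i : 0 <= Q'`_i by apply: le_trans (QQ' i).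
exists (P' * Q') => [i|]; last by rewrite rmorphM ler_pM // zhorner_ge0.
rewrite !coefM; apply: le_trans (ler_norm_sum _ _ _) _; apply: ler_sum => j _.
by rewrite normrM ler_pM.
Qed.

Lemma dominatedX P k : dominated R P -> dominated R (fun n => P n ^+ k).
Proof.
move=> dP; elim: k => [|k IH].
  move=> s _; exists 1 => n; exists 1; last by rewrite rmorph1.
  by move=> i; rewrite expr0 coef1; case: eqP.
by under eq_fun do rewrite exprS; exact: dominatedM.
Qed.

(** The majorant has all signs positive; its value at s is at most the product of exp(s^k), hence at
    most exp(1 / (1 - s)). *)
Lemma dominated_qprod (e : {poly int}) i r : e * e = 1 -> (0 < r)%N ->
  dominated R (qprod 'X e i r).
Proof.
move=> e2 r0 s /andP[s0 s1]; exists (expR (1 / (1 - s))) => n.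
exists (qprod 'X (-1) i r n).
  (* From e^2 = 1, [e] is a unit of Z[X], hence the constant 1 or -1. *)
  have [c ec c1] : exists2 c : int, e = c%:P & `|c| = 1.
    have : e \is a GRing.unit by apply/unitrP; exists e.
    rewrite poly_unitE => /andP[/size_poly1P[c c0 ->]] ; rewrite coefC /= => uc.
    by exists c => //; case/orP: uc => /eqP ->.
  elim: n => [|n IH] j; first by rewrite /qprod !big_ord0 coef1; case: eqP.
  rewrite !qprodS !mulrBr !mulr1 mulN1r mulrN opprK !mulrA coefB coefD !coefMXn.
  apply: le_trans (ler_normB _ _) _; apply: lerD => //.
  case: ifP => _; first by rewrite normr0.
  by rewrite ec [_ * c%:P]mulrC mul_polyC coefZ -ec normrM c1 mul1r.
rewrite rmorph_qprod rmorphN1 /= zhornerX /qprod.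
have le_exp : \prod_(k < n) (1 - -1 * s ^+ (i + r * k)) <= \prod_(k < n) expR (s ^+ k).
  apply: ler_prod => k _; rewrite mulN1r opprK addr_ge0 ?exprn_ge0 ?(ltW s0) //=.
  apply: le_trans (expR_ge1Dx _) _; rewrite ler_expR.
  by apply: ler_wiXn2l; rewrite ?(ltW s0) ?(ltW s1) //; nia.
apply: le_trans le_exp _; rewrite -expR_sum ler_expR.
have := @geometric_le_lim R n 1 s ler01 s0; rewrite gtr0_norm // => /(_ s1).
rewrite /series /= big_mkord.
by under [X in X <= _ -> _]eq_bigr do rewrite /geometric /= mul1r.
Qed.

(** A Cauchy estimate: one term of the majorant is at most its value at s. *)
Lemma dominated_coef P (s : R) : dominated R P -> 0 < s < 1 ->
  exists K : R, forall n i, `|(P n)`_i|%:~R * s ^+ i <= K.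
Proof.
move=> dP s01; have [K HK] := dP s s01; exists K => n i.
have [Q PQ QK] := HK n; apply: le_trans QK.
have s0 : 0 <= s by case/andP: s01 => /ltW.
have Q0 j : 0 <= Q`_j by apply: le_trans (PQ j).
have t0 j : 0 <= (Q`_j)%:~R * s ^+ j by rewrite mulr_ge0 ?exprn_ge0 // ler0z.
rewrite (@zhorner_coef_wide _ _ _ (maxn (size Q) i.+1)) ?leq_maxl // big_mkord.
rewrite (bigD1 (Ordinal (leq_maxr (size Q) i.+1))) //=.
apply: ler_wpDr; first by rewrite sumr_ge0.
by rewrite ler_wpM2r ?exprn_ge0 // ler_int.
Qed.

End Dominated.

(** * Power series expansions: convergence and uniqueness of coefficients *)

Lemma cvg_sub0 (K : numFieldType) (u v : nat -> K) (l : K) :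
  u @ \oo --> l -> (fun n => v n - u n) @ \oo --> (0 : K) -> v @ \oo --> l.
Proof.
move=> ul vu0; rewrite -[l]addr0.
have -> : v = (fun n => u n + (v n - u n)) by apply/funext => n; rewrite addrC subrK.
exact: cvgD.
Qed.

Section Expansion.
Variable R : realType.
Local Notation C := (Num.NumField.sort (R[i] : numFieldType)).

Lemma disc_radius (q : C) : `|q| < 1 ->
  exists r s : R, [/\ 0 <= r, r < s, 0 < s, s < 1 & `|q| = r%:C].
Proof.
have [r r0 ->] := normc_real q; rewrite -[1]/(1%:C) ltcR => r1.
by exists r, ((r + 1) / 2); split=> //; lra.
Qed.

Lemma norm_zterm (q : C) (r : R) (z : int) i :
  `|q| = r%:C -> `|z%:~R * q ^+ i| = (`|z|%:~R * r ^+ i)%:C.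
Proof. by move=> qr; rewrite normrM normrX qr -intr_norm rmorphM rmorphXn rmorph_int. Qed.

(** P_n(q) and the n-th partial sum agree below degree n by stability. With t = |q| / s the
    remaining terms are at most K t^i, so the difference is at most K t^n / (1 - t). *)
Lemma cvg_zhorner P (q : C) : coef_stable P -> dominated R P -> `|q| < 1 ->
  exists2 l : C, zpseries (fun i => (P i.+1)`_i) q @ \oo --> l &
    (fun n => zhorner q (P n)) @ \oo --> l.
Proof.
move=> sP dP /disc_radius[r [s [r0 rs s0 s1 qr]]].
have [K HK] := dominated_coef dP (introT andP (conj s0 s1)).
pose t := r / s.
have t0 : 0 <= t by rewrite divr_ge0 // ltW.
have t1 : t < 1 by rewrite ltr_pdivrMr // mul1r.
have K0 : 0 <= K by apply: le_trans (HK 0%N 0%N); rewrite mulr1 ler0z.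
have bnd n i : `|((P n)`_i)%:~R * q ^+ i| <= (K * t ^+ i)%:C.
  rewrite (norm_zterm _ _ qr) lecR.
  have -> : r ^+ i = s ^+ i * t ^+ i by rewrite -exprMn mulrC divfK ?gt_eqF.
  by rewrite mulrA ler_wpM2r ?exprn_ge0.
have /cvg_ex[l ul] : cvgn (zpseries (fun i => (P i.+1)`_i) q).
  by apply: (@is_cvg_series_geometric_bound R _ K t) => [|n]; rewrite ?t0.
exists l => //; apply: cvg_sub0 ul _.
apply: (@cvg_complex_dist R _ _ (geometric (K / (1 - t)) t)) => [n|]; last first.
  by apply: cvg_geometric; rewrite ger0_norm.
rewrite sub0r normrN (@zhorner_coef_wide _ _ _ (n + size (P n))) ?leq_addl //.
rewrite (@big_cat_nat _ _ _ n) ?leq_addr //= /zpseries /series /= [X in X - _]addrC.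
rewrite (@eq_big_nat _ _ _ 0 n (fun i => ((P i.+1)`_i)%:~R * q ^+ i)
  (fun i => ((P n)`_i)%:~R * q ^+ i)) => [|i /andP[_ lt_in]]; last by rewrite (sP i n).
rewrite addrK; apply: le_trans (ler_norm_sum _ _ _) _.
apply: le_trans (ler_sum _ (fun i _ => bnd n i)) _.
rewrite -rmorph_sum lecR /= -mulr_sumr geometric_partial_tail geometric_seriesE ?lt_eqF //=.
set w := t ^+ size (P n); set v := (1 - t)^-1.
have -> : K * (t ^+ n * (1 - w) * v) = K * v * t ^+ n * (1 - w) by ring.
apply: ler_piMr; last by rewrite gerBl exprn_ge0.
by rewrite mulr_ge0 ?mulr_ge0 ?exprn_ge0 // invr_ge0 subr_ge0 ltW.
Qed.

(** At a small positive real point the first nonzero term, whose coefficient is an integer of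
    absolute value at least 1, outweighs the whole tail. *)
Lemma zpseries_eq0 (c : nat -> int) :
  (forall q : C, `|q| < 1 -> zpseries c q @ \oo --> (0 : C)) -> forall n, c n = 0.
Proof.
move=> c0; elim/ltn_ind => m IH; apply/eqP/negPn/negP => cm.
pose S (t : R) n := \sum_(0 <= i < n) (c i)%:~R * t ^+ i.
have SE t n : zpseries c (t%:C) n = (S t n)%:C.
  rewrite /zpseries /series /= rmorph_sum; apply: eq_bigr => i _.
  by rewrite rmorphM rmorph_int rmorphXn.
have S0 t e : 0 <= t < 1 -> 0 < e -> exists N, forall n, (N <= n)%N -> `|S t n| < e.
  move=> /andP[t0 t1] e0; have := c0 t%:C.
  rewrite normc_realC ger0_norm // -[1]/(1%:C) ltcR => /(_ t1) /cvgrPdist_lt.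
  move=> /(_ e%:C); rewrite -[0]/(0%:C) ltcR => /(_ e0)[N _ HN].
  exists N => n /HN /=; rewrite SE -rmorphB sub0r normc_realC ltcR.
  by rewrite normrN.
(* Partial sums at 1/2 are eventually below 1/2, so late terms are at most 1; the finitely many
   early ones are absorbed into [K]. *)
have [K K1 HK] : exists2 K : R, 1 <= K & forall n, `|c n|%:~R * (1 / 2) ^+ n <= K.
  have [|//|N HN] := S0 (1 / 2) (1 / 2); first by lra.
  exists (1 + \sum_(i < N) `|c i|%:~R).
    by rewrite lerDl sumr_ge0 // => i _; rewrite ler0z.
  move=> n; case: (ltnP n N) => [lt_nN|le_Nn].
    rewrite (bigD1 (Ordinal lt_nN)) //= addrCA ler_wpDr //.
      by rewrite addr_ge0 // sumr_ge0 // => i _; rewrite ler0z.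
    by rewrite ler_piMr ?ler0z // exprn_ile1 //; lra.
  apply: le_trans (_ : 1 <= _); last by rewrite lerDl sumr_ge0 // => i _; rewrite ler0z.
  have := HN n le_Nn; have := HN n.+1 (leqW le_Nn).
  rewrite /S big_nat_recr //= -/(S _ n) intr_norm => h1 h2.
  have -> : `|(c n)%:~R| * (1 / 2) ^+ n = `|(c n)%:~R * (1 / 2) ^+ n| :> R.
    by rewrite normrM (@ger0_norm _ (_ ^+ _)) // exprn_ge0 //; lra.
  rewrite -[X in `|X|](addKr (S (1 / 2) n)).
  by apply: le_trans (ler_normD _ _) _; rewrite normrN; lra.
pose sm : R := (1 / 2) ^+ m.
have sm0 : 0 < sm by rewrite exprn_gt0 //; lra.
have sm1 : sm <= 1 by rewrite exprn_ile1 //; lra.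
(* Evaluation is at x / 2. The choice K x = 2^(-m) / 4 with x <= 1/4 makes the tail at most half of
   the lower bound for the head. *)
pose x := sm / (4 * K).
have x0 : 0 < x by rewrite divr_gt0 //; lra.
have xK : K * x = sm / 4 by rewrite /x; field; lra.
have x1 : x <= 1 / 4 by nra.
clearbody x; have xm0 : 0 < x ^+ m by rewrite exprn_gt0.
have [||N HN] := S0 (x * (1 / 2)) (x ^+ m * sm / 2); first by lra.
  by rewrite divr_gt0 // mulr_gt0.
have := HN (N + m.+1)%N (leq_addr _ _); apply/negP; rewrite -leNgt.
rewrite /S (@big_cat_nat _ _ _ m) //=; last by lia.
rewrite big_nat big1 ?add0r => [|i /IH ->]; last by rewrite mul0r.
rewrite big_ltn; last by lia.
have -> : (N + m.+1 = m.+1 + N)%N by lia.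
have tail : `|\sum_(m.+1 <= i < m.+1 + N) (c i)%:~R * (x * (1 / 2)) ^+ i| <=
    K * (x ^+ m.+1 / (1 - x)).
  apply: le_trans (ler_norm_sum _ _ _) _.
  apply: le_trans (_ : \sum_(m.+1 <= i < m.+1 + N) K * x ^+ i <= _).
    apply: ler_sum => i _; rewrite normrM exprMn -intr_norm.
    have h0 : 0 <= (1 / 2 : R) ^+ i by rewrite exprn_ge0 //; lra.
    have xi0 : 0 <= x ^+ i by rewrite exprn_ge0 // ltW.
    by rewrite (ger0_norm (mulr_ge0 xi0 h0)) mulrCA mulrC ler_wpM2r.
  rewrite -mulr_sumr ler_wpM2l //; first by lra.
  rewrite geometric_partial_tail; apply: geometric_le_lim => //.
    by rewrite exprn_ge0 // ltW.
  by rewrite ger0_norm; lra.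
have head : x ^+ m * sm <= `|(c m)%:~R * (x * (1 / 2)) ^+ m|.
  rewrite normrM exprMn -/sm (ger0_norm (mulr_ge0 (ltW xm0) (ltW sm0))).
  apply: ler_peMl; first exact: mulr_ge0 (ltW xm0) (ltW sm0).
  by rewrite -intr_norm ler1z; lia.
have tail2 : K * (x ^+ m.+1 / (1 - x)) <= x ^+ m * sm / 2.
  rewrite exprS !mulrA xK ler_pdivrMr; last by lra.
  have ws := mulr_gt0 xm0 sm0.
  have := mulr_ge0 (ltW ws) (_ : 0 <= 1 / 4 - x); rewrite subr_ge0 => /(_ x1).
  by move: (x ^+ m) ws => w; lra.
apply: le_trans (lerB_normD _ _); lra.
Qed.

Lemma bernoulli_ineq (y : R) a : 0 <= y <= 1 -> 1 - a%:R * y <= (1 - y) ^+ a.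
Proof.
move=> y01; elim: a => [|a IH]; first by rewrite mul0r subr0.
have a0 : 0 <= a%:R :> R by [].
by rewrite exprSr -natr1; nra.
Qed.

(** Coefficients of index a n + b are at most K / s'^(a n + b), so a geometric series of ratio |q| /
    s'^a dominates. *)
Lemma is_cvg_zpseries_progression P a b (q : C) : (0 < a)%N ->
  dominated R P -> `|q| < 1 ->
  cvgn (zpseries (fun n => (P (a * n + b).+1)`_(a * n + b)) q).
Proof.
move=> a0 dP /disc_radius[r [s [r0 rs s0 s1 qr]]].
have aR0 : 0 < a%:R :> R by rewrite ltr0n.
have aR1 : 1 <= a%:R :> R by rewrite ler1n.
(* Bernoulli's inequality gives |q| < s <= s'^a, in place of an a-th root of s. *)
pose s' := 1 - (1 - s) / a%:R.
have y0 : 0 < (1 - s) / a%:R by rewrite divr_gt0 //; lra.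
have y1 : (1 - s) / a%:R <= 1 - s by rewrite ler_pdivrMr //; nra.
have s'01 : 0 < s' < 1 by rewrite /s'; lra.
have ss' : s <= s' ^+ a.
  have := @bernoulli_ineq ((1 - s) / a%:R) a; rewrite -/s' mulrCA divff ?gt_eqF //.
  by rewrite mulr1 subKr => -> //; lra.
have [K HK] := dominated_coef dP s'01; have [s'0 s'1] := andP s'01.
have t0 : 0 <= r / s' ^+ a by rewrite divr_ge0 // exprn_ge0 // ltW.
have t1 : r / s' ^+ a < 1 by rewrite ltr_pdivrMr ?exprn_gt0 // mul1r (lt_le_trans rs).
apply: (@is_cvg_series_geometric_bound R _ (K / s' ^+ b) (r / s' ^+ a)).
  by rewrite t0.
move=> n; rewrite (norm_zterm _ _ qr) lecR.
have -> : K / s' ^+ b * (r / s' ^+ a) ^+ n = K / s' ^+ (a * n + b) * r ^+ n.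
  by rewrite exprMn exprVn -exprM exprD invfM; ring.
by rewrite ler_wpM2r ?exprn_ge0 // ler_pdivlMr ?exprn_gt0.
Qed.

(** Each factor satisfies |1 - q^(k+1)| >= exp(-s^k / (1 - s)), so the partial products stay above
    exp(-1 / (1 - s)^2). This permits division by f_1. *)
Lemma cvg_euler_neq0 (q l : C) : `|q| < 1 ->
  (fun n => qprod q 1 1 1 n) @ \oo --> l -> l != 0.
Proof.
move=> /disc_radius[r [s [r0 rs s0 s1 qr]]] ql.
pose y k := s ^+ k / (1 - s).
have y0 k : 0 <= y k by rewrite divr_ge0 ?exprn_ge0 ?subr_ge0 ?ltW.
pose B := expR (- (1 / (1 - s) / (1 - s))).
have lowB n : B%:C <= `|qprod q 1 1 1 n|.
  rewrite /qprod normr_prod.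
  apply: le_trans (_ : (\prod_(k < n) expR (- y k))%:C <= _).
    rewrite lecR -expR_sum ler_expR sumrN lerN2 -mulr_suml.
    rewrite ler_pM2r ?invr_gt0 ?subr_gt0 //.
    have := @geometric_le_lim R n 1 s ler01 s0; rewrite gtr0_norm // => /(_ s1).
    rewrite /series /= big_mkord.
    by under [X in X <= _ -> _]eq_bigr do rewrite /geometric /= mul1r.
  rewrite rmorph_prod; apply: ler_prod => k _; rewrite -[0]/(0%:C) lecR expR_ge0 /=.
  rewrite mul1r mul1n add1n; apply: le_trans (lerB_dist _ _).
  rewrite normr1 normrX qr -rmorphXn -[1]/(1%:C) -rmorphB lecR.
  have rk : r ^+ k.+1 <= s ^+ k.+1 by rewrite lerXn2r ?nnegrE // ltW.
  have sk : s ^+ k.+1 <= s ^+ k by rewrite ler_wiXn2l // ltW.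
  have sk1 : s ^+ k.+1 <= s by rewrite exprSr ler_piMl ?exprn_ile1 // ltW.
  rewrite expRN -[X in X <= _]mul1r ler_pdivrMr ?expR_gt0 //.
  apply: le_trans (_ : (1 - r ^+ k.+1) * (1 + y k) <= _); last first.
    by rewrite ler_wpM2l ?expR_ge1Dx // subr_ge0; lra.
  have yE : y k * (1 - s) = s ^+ k by rewrite divfK // subr_eq0 gt_eqF.
  have := y0 k; move: (y k) yE => Y yE Y0; nra.
apply/eqP => l0; rewrite l0 in ql.
move/cvgrPdist_lt: ql => /(_ B%:C); rewrite -[0 : C]/(0%:C) ltcR expR_gt0 => /(_ isT).
move=> [n _ /(_ n (leqnn n))] /=; rewrite sub0r normrN => /(le_lt_trans (lowB n)).
by rewrite ltxx.
Qed.

End Expansion.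

(** * Limits of the truncations and identification of the coefficients *)

Lemma cvg_exprn (K : numFieldType) (u : nat -> K) (l : K) k :
  u @ \oo --> l -> (fun n => u n ^+ k) @ \oo --> l ^+ k.
Proof.
move=> ul; elim: k => [|k IH]; first by rewrite expr0; exact: cvg_cst.
by rewrite exprS; under eq_fun do rewrite exprS; exact: cvgM.
Qed.

Lemma cvg_cube_mul (K : numFieldType) (u1 u2 u3 u4 : nat -> K) (l1 l2 l3 l4 : K) :
  u1 @ \oo --> l1 -> u2 @ \oo --> l2 -> u3 @ \oo --> l3 -> u4 @ \oo --> l4 ->
  (fun n => (u1 n * u2 n) ^+ 3 * (u3 n * u4 n)) @ \oo -->
    (l1 * l2) ^+ 3 * (l3 * l4).
Proof.
by move=> c1 c2 c3 c4; apply: cvgM; [apply: cvg_exprn|]; exact: cvgM.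
Qed.

Lemma cvg_zpseriesB (K : numFieldType) (c d : nat -> int) (q a b : K) :
  zpseries c q @ \oo --> a -> zpseries d q @ \oo --> b ->
  zpseries (fun i => c i - d i) q @ \oo --> a - b.
Proof.
move=> ca db; have -> : zpseries (fun i => c i - d i) q = zpseries c q - zpseries d q.
  apply/funext => n; rewrite /zpseries /series fctE /= -sumrB.
  by apply: eq_bigr => k _; rewrite rmorphB mulrBl.
exact: cvgB.
Qed.

Lemma cvg_zpseriesZ (K : numFieldType) (k : nat) (c : nat -> int) (q a : K) :
  zpseries c q @ \oo --> a ->
  zpseries (fun i => k%:R * c i) q @ \oo --> k%:R * a.
Proof.
move=> ca; have -> : zpseries (fun i => k%:R * c i) q = (fun n => k%:R * zpseries c q n).
  apply/funext => n; rewrite /zpseries /series /= mulr_sumr.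
  by apply: eq_bigr => i _; rewrite rmorphM rmorph_nat mulrA.
exact: cvgMr.
Qed.

Section PolynomialLimits.
Variables (K : numFieldType) (q : K).
Hypothesis cvg1 : forall i r, (0 < r)%N ->
  (fun n => qprod q 1 i r n) @ \oo --> qpoch (q ^+ i) (q ^+ r).
Hypothesis cvgN1 : forall i r, (0 < r)%N ->
  (fun n => qprod q (-1) i r n) @ \oo --> qpoch (- q ^+ i) (q ^+ r).

Lemma cvg_zhorner_cpoly : (fun n => zhorner q (cpoly n)) @ \oo -->
  qpochs [:: - q; - q ^+ 4] (q ^+ 5) ^+ 3 * qpochs [:: q ^+ 3; q ^+ 7] (q ^+ 10).
Proof.
under eq_fun do rewrite rmorph_cpoly /= zhornerX.
rewrite /qpochs !big_cons !big_nil !mulr1 -[X in qpoch (- X) _]expr1.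
by apply: cvg_cube_mul; [exact: cvgN1|exact: cvgN1|exact: cvg1|exact: cvg1].
Qed.

Lemma cvg_zhorner_dpoly : (fun n => zhorner q (dpoly n)) @ \oo -->
  qpochs [:: - q ^+ 2; - q ^+ 3] (q ^+ 5) ^+ 3 * qpochs [:: q; q ^+ 9] (q ^+ 10).
Proof.
under eq_fun do rewrite rmorph_dpoly /= zhornerX.
rewrite /qpochs !big_cons !big_nil !mulr1 -[X in qpoch X (q ^+ 10) * _]expr1.
by apply: cvg_cube_mul; [exact: cvgN1|exact: cvgN1|exact: cvg1|exact: cvg1].
Qed.

(** Passing to the limit in (q; q) (-q; q) = (q^2; q^2) gives (-q; q) = f_2 / f_1. *)
Lemma cvg_zhorner_epoly : feuler 1 q != 0 ->
  (fun n => zhorner q (epoly n)) @ \oo --> feuler 2 q ^+ 4 / feuler 1 q ^+ 4.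
Proof.
move=> f1; under eq_fun do rewrite /epoly rmorphXn rmorph_qprod rmorphN1 /= zhornerX.
rewrite -expr_div_n; apply: cvg_exprn.
suff -> : feuler 2 q / feuler 1 q = qpoch (- q ^+ 1) (q ^+ 1) by exact: cvgN1.
apply: (mulIf f1); rewrite divfK // mulrC.
have c2 : (fun n => qprod q 1 1 1 n * qprod q (-1) 1 1 n) @ \oo --> feuler 2 q.
  by under eq_fun do rewrite qprod_sqr ?mulr1 //; exact: (@cvg1 2 2).
apply: cvg_unique c2 _; first exact: norm_hausdorff.
by apply: cvgM; [exact: cvg1|exact: cvgN1].
Qed.

End PolynomialLimits.

Section Expands.
Variable R : realType.
Local Notation C := (Num.NumField.sort (R[i] : numFieldType)).

Lemma cvgn_unique (u : nat -> C) (l l' : C) :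
  u @ \oo --> l -> u @ \oo --> l' -> l = l'.
Proof. by apply: cvg_unique; exact: norm_hausdorff. Qed.

(** [cvg_zhorner] supplies the existence of the limit, so [qpoch], defined through [limn], is a
    genuine limit. *)
Lemma cvg_qprod (q : C) (e : int) i r : e * e = 1 -> (0 < r)%N -> `|q| < 1 ->
  (fun n => qprod q e%:~R i r n) @ \oo --> qpoch (e%:~R * q ^+ i) (q ^+ r).
Proof.
move=> e2 r0 q1; have ee : e%:P * e%:P = 1 :> {poly int} by rewrite -polyCM e2.
have := cvg_zhorner (@coef_stable_qprod e%:P i r r0) (@dominated_qprod R _ i r ee r0) q1.
move=> [l _]; rewrite (_ : (fun n => zhorner q _) = qprod q e%:~R i r); last first.
  apply/funext => n; rewrite rmorph_qprod /= zhornerX; congr (qprod q _ i r n).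
  by rewrite /zhorner /= map_polyC /horner_eval hornerC.
move=> ql; suff -> : qpoch (e%:~R * q ^+ i) (q ^+ r) = l by [].
rewrite /qpoch; apply: cvg_lim; first exact: norm_hausdorff.
rewrite (_ : (fun n => _) = qprod q e%:~R i r) //; apply/funext => n.
rewrite big_mkord; apply: eq_bigr => k _.
by rewrite -mulrA -exprM -exprD.
Qed.

Lemma cvg_qprod1 (q : C) i r : (0 < r)%N -> `|q| < 1 ->
  (fun n => qprod q 1 i r n) @ \oo --> qpoch (q ^+ i) (q ^+ r).
Proof.
move=> r0 q1; have := @cvg_qprod q 1 i r erefl r0 q1.
by rewrite !mulr1z mul1r.
Qed.

Lemma cvg_qprodN1 (q : C) i r : (0 < r)%N -> `|q| < 1 ->
  (fun n => qprod q (-1) i r n) @ \oo --> qpoch (- q ^+ i) (q ^+ r).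
Proof.
move=> r0 q1; have := @cvg_qprod q (-1) i r erefl r0 q1.
by rewrite !mulrN1z mulN1r.
Qed.

Lemma expands_coef (c : nat -> int) P (F : C -> C) :
  coef_stable P -> dominated R P ->
  (forall q : C, `|q| < 1 -> (fun n => zhorner q (P n)) @ \oo --> F q) ->
  expands c F -> forall i, c i = (P i.+1)`_i.
Proof.
move=> sP dP PF cF i; apply/eqP; rewrite -subr_eq0; apply/eqP; move: i.
apply: (@zpseries_eq0 R) => q q1; have [l pl Pl] := cvg_zhorner sP dP q1.
have <- : F q - l = 0 by rewrite (cvgn_unique (PF q q1) Pl) subrr.
exact: cvg_zpseriesB (cF q q1) pl.
Qed.

Lemma coef_stable_cpoly : coef_stable cpoly.
Proof.
by do ?[apply: coef_stableM | apply: coef_stableX]; apply: coef_stable_qprod.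
Qed.

Lemma coef_stable_dpoly : coef_stable dpoly.
Proof.
by do ?[apply: coef_stableM | apply: coef_stableX]; apply: coef_stable_qprod.
Qed.

Lemma coef_stable_epoly : coef_stable epoly.
Proof. by apply: coef_stableX; exact: coef_stable_qprod. Qed.

Lemma dominated_cpoly : dominated R cpoly.
Proof.
by do ?[apply: dominatedM | apply: dominatedX]; apply: dominated_qprod;
  rewrite // ?mulrNN mulr1.
Qed.

Lemma dominated_dpoly : dominated R dpoly.
Proof.
by do ?[apply: dominatedM | apply: dominatedX]; apply: dominated_qprod;
  rewrite // ?mulrNN mulr1.
Qed.

Lemma dominated_epoly : dominated R epoly.
Proof. by apply: dominatedX; apply: dominated_qprod; rewrite // mulrNN mulr1. Qed.

Lemma expands_cpoly (c : nat -> int) :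
  expands c (fun q : C => qpochs [:: - q; - q ^+ 4] (q ^+ 5) ^+ 3 *
    qpochs [:: q ^+ 3; q ^+ 7] (q ^+ 10)) ->
  forall i, c i = (cpoly i.+1)`_i.
Proof.
apply: expands_coef => [||q q1]; first exact: coef_stable_cpoly.
  exact: dominated_cpoly.
by apply: cvg_zhorner_cpoly => i r r0; [exact: cvg_qprod1|exact: cvg_qprodN1].
Qed.

Lemma expands_dpoly (d : nat -> int) :
  expands d (fun q : C => qpochs [:: - q ^+ 2; - q ^+ 3] (q ^+ 5) ^+ 3 *
    qpochs [:: q; q ^+ 9] (q ^+ 10)) ->
  forall i, d i = (dpoly i.+1)`_i.
Proof.
apply: expands_coef => [||q q1]; first exact: coef_stable_dpoly.
  exact: dominated_dpoly.
by apply: cvg_zhorner_dpoly => i r r0; [exact: cvg_qprod1|exact: cvg_qprodN1].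
Qed.

Lemma cvg_epoly (q : C) : `|q| < 1 ->
  zpseries (fun i => (epoly i.+1)`_i) q @ \oo -->
    feuler 2 q ^+ 4 / feuler 1 q ^+ 4.
Proof.
move=> q1; have [l el El] := cvg_zhorner coef_stable_epoly dominated_epoly q1.
suff <- : l = feuler 2 q ^+ 4 / feuler 1 q ^+ 4 by [].
have c1 i r : (0 < r)%N -> _ := fun r0 => @cvg_qprod1 q i r r0 q1.
have cN i r : (0 < r)%N -> _ := fun r0 => @cvg_qprodN1 q i r r0 q1.
have f1 : feuler 1 q != 0 := cvg_euler_neq0 q1 (c1 1%N 1%N isT).
exact: cvgn_unique El (@cvg_zhorner_epoly _ q c1 cN f1).
Qed.

End Expands.

Theorem theorem9 (R : realType) (c d : nat -> int)
  (hc : expands c (fun q : R[i] =>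
      qpochs [:: - q; - q ^+ 4] (q ^+ 5) ^+ 3 *
      qpochs [:: q ^+ 3; q ^+ 7] (q ^+ 10)))
  (hd : expands d (fun q : R[i] =>
      qpochs [:: - q ^+ 2; - q ^+ 3] (q ^+ 5) ^+ 3 *
      qpochs [:: q; q ^+ 9] (q ^+ 10))) :
  [/\ forall n : nat,
        [/\ c (5 * n)%N = d (5 * n)%N,
            c (5 * n + 2)%N = d (5 * n + 2)%N,
            c (5 * n + 3)%N = d (5 * n + 3)%N
          & c (5 * n + 4)%N = d (5 * n + 4)%N],
      forall q : R[i], `|q| < 1 ->
        let c1 := zpseries (fun n => c (5 * n + 1)%N) q in
        let d1 := zpseries (fun n => d (5 * n + 1)%N) q in
        [/\ cvgn c1, cvgn d1
          & limn c1 - limn d1 = 4 * (feuler 2 q ^+ 4 / feuler 1 q ^+ 4)]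
    & forall n : nat, d (5 * n + 1)%N < c (5 * n + 1)%N].
Proof.
have cE := expands_cpoly hc; have dE := expands_dpoly hd.
(* Stability moves the coefficient from the truncation of order i + 1 to that of order i / 5 + 1,
   the one in the series of [cvg_epoly]. *)
have cdE i : c i - d i =
    if (i %% 5 == 1)%N then 4 * (epoly (i %/ 5).+1)`_(i %/ 5) else 0.
  rewrite cE dE coef_cpolyB // coef_stable_epoly //.
  by rewrite ltnS leq_div.
split.
- have eq_cd i : (i %% 5 != 1)%N -> c i = d i.
    by move=> i5; apply/eqP; rewrite -subr_eq0 cdE ifN.
  by move=> n; split; apply: eq_cd; lia.
- move=> q q1 c1 d1.
  have cc : cvgn c1.
    rewrite /c1 (_ : (fun n => c _) = fun n => (cpoly (5 * n + 1).+1)`_(5 * n + 1)).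
      exact: is_cvg_zpseries_progression (@dominated_cpoly R) q1.
    by apply/funext => n; exact: cE.
  have cd : cvgn d1.
    rewrite /d1 (_ : (fun n => d _) = fun n => (dpoly (5 * n + 1).+1)`_(5 * n + 1)).
      exact: is_cvg_zpseries_progression (@dominated_dpoly R) q1.
    by apply/funext => n; exact: dE.
  (* Both sides are limits of the series with coefficients c_(5n+1) - d_(5n+1). *)
  split=> //; apply: cvgn_unique (cvg_zpseriesB cc cd) _.
  have := @cvg_zpseriesZ _ 4 _ _ _ (cvg_epoly q1).
  rewrite (_ : (fun i => _) = fun n => c (5 * n + 1)%N - d (5 * n + 1)%N) //.
  apply/funext => n; rewrite cdE ifT; last by lia.
  by rewrite (_ : ((5 * n + 1) %/ 5 = n)%N) //; lia.
- move=> n; rewrite -subr_gt0 cdE ifT; last by lia.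
  by rewrite mulr_gt0 // epoly_coef_gt0.
Qed.
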